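(* Let $(Z^{\bullet,j},d^{\bullet,j})$, $S^{i,j}$, $P^{i,j}$ be as described in the context, with associated operators $d^i$, $S^i$, $P^i$, $d_V^i=d^i-S^i$ on the spaces $Y^i$, and $F^i=(I-P^{i+1}S^i)^{-1}$. Define $$P_V^i:=F^{i-1}P^i(F^i)^{-1}=\sum_{l=0}^\infty (P^iS^{i-1})^lP^i(I-P^{i+1}S^i):Y^i\to Y^{i-1}.$$ Then $$d_V^{i-1}P_V^i+P_V^{i+1}d_V^i=I\ \text{ for } i>0,\qquad\text{and}\qquad d_V^0P_V^1d_V^0=d_V^0 .$$
   Context: For $0\le i\le n$, $0\le j\le N$ let $Z^{i,j}$ be Hilbert spaces; spaces with indices out of range, and operators from or to them, are zero. Let $d^{i,j}:Z^{i,j}\to Z^{i+1,j}$ be bounded linear operators with $d^{i+1,j}d^{i,j}=0$, and let $S^{i,j}:Z^{i,j}\to Z^{i+1,j-1}$ be bounded linear operators with $d^{i+1,j-1}S^{i,j}=-S^{i+1,j}d^{i,j}$ and $S^{i+1,j-1}S^{i,j}=0$ for all $i,j$. Let $P^{i,j}:Z^{i,j}\to Z^{i-1,j}$, $i=1,\dots,n$, be bounded linear operators with $d^{i-1,j}P^{i,j}+P^{i+1,j}d^{i,j}=I_{Z^{i,j}}$ for $i>0$ and $d^{0,j}P^{1,j}d^{0,j}=d^{0,j}$. Put $Y^i=Z^{i,0}\times\cdots\times Z^{i,N}$; $d^i:Y^i\to Y^{i+1}$ and $P^i:Y^i\to Y^{i-1}$ act componentwise through $d^{i,j}$, $P^{i,j}$,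 and $S^i:Y^i\to Y^{i+1}$ is $S^i(u_0,\dots,u_N)=(S^{i,1}u_1,\dots,S^{i,N}u_N,0)$. The twisted complex is $(Y^\bullet,d_V^\bullet)$ with $d_V^i=d^i-S^i$. Since $P^{i+1}S^i:Y^i\to Y^i$ maps the component $Z^{i,j}$ to $Z^{i,j-1}$, it is nilpotent, so $I-P^{i+1}S^i$ is invertible and $F^i:=(I-P^{i+1}S^i)^{-1}=\sum_{l\ge0}(P^{i+1}S^i)^l$ is a finite sum. *)

(* Defs.v *)
From HB Require Import structures.
From mathcomp Require Import all_boot all_order all_algebra.
From mathcomp Require Import all_classical all_reals all_analysis.
From mathcomp Require Import sesquilinear.
From mathcomp Require Import complex.

Set Implicit Arguments.
Unset Strict Implicit.
Unset Printing Implicit Defensive.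

Import Order.TTheory GRing.Theory Num.Theory.
Import numFieldNormedType.Exports.

Local Open Scope ring_scope.

Variant scalar_kind := RealScalars | ComplexScalars.

Definition scalars (R : realType) (k : scalar_kind) : numFieldType :=
  match k with
  | RealScalars => R
  | ComplexScalars => complex.complex R
  end.

Definition scalar_conj (R : realType) (k : scalar_kind) :
    scalars R k -> scalars R k :=
  match k with
  | RealScalars => idfun
  | ComplexScalars => @Num.conj (complex.complex R)
  end.

(* [{dot V for _}] is linear in its first argument, conjugate-linear in the
   second, Hermitian and positive definite. *)
Record hilbertType (R : realType) (k : scalar_kind) := Hilbert {
  hilbert_sort :> completeNormedModType (scalars R k);
  hilbert_dot : {dot hilbert_sort for @scalar_conj R k};
  hilbert_normE : forall x, `|x| ^+ 2 = hilbert_dot x x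
}.

Definition bounded_operator (K : numFieldType) (V W : normedModType K)
    (f : V -> W) : Prop :=
  exists M : K, forall x, `|f x| <= M * `|x|.

Section ProductModule.
Variables (K : pzRingType) (I : finType) (T : I -> lmodType K).

Definition prod_lmod := {dffun forall j, T j}.

HB.instance Definition _ := Choice.on prod_lmod.

Implicit Types u v w : prod_lmod.

Let prod_zero : prod_lmod := finfun (fun j => 0 : T j).
Let prod_opp u : prod_lmod := finfun (fun j => - u j).
Let prod_add u v : prod_lmod := finfun (fun j => u j + v j).
Let prod_scale a u : prod_lmod := finfun (fun j => a *: u j).

Let prod_addA : associative prod_add.
Proof. by move=> u v w; apply/ffunP => j; rewrite !ffunE addrA. Qed.
Let prod_addC : commutative prod_add.
Proof. by move=> u v; apply/ffunP => j; rewrite !ffunE addrC. Qed.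
Let prod_add0 : left_id prod_zero prod_add.
Proof. by move=> u; apply/ffunP => j; rewrite !ffunE add0r. Qed.
Let prod_addN : left_inverse prod_zero prod_opp prod_add.
Proof. by move=> u; apply/ffunP => j; rewrite !ffunE addNr. Qed.

HB.instance Definition _ := GRing.isZmodule.Build prod_lmod
  prod_addA prod_addC prod_add0 prod_addN.

Let prod_scaleA a b u : prod_scale a (prod_scale b u) = prod_scale (a * b) u.
Proof. by apply/ffunP => j; rewrite !ffunE scalerA. Qed.
Let prod_scale1 : left_id 1 prod_scale.
Proof. by move=> u; apply/ffunP => j; rewrite !ffunE scale1r. Qed.
Let prod_scaleDr : right_distributive prod_scale +%R.
Proof. by move=> a u v; apply/ffunP => j; rewrite !ffunE scalerDr. Qed.
Let prod_scaleDl u : {morph prod_scale^~ u : a b / a + b}.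
Proof. by move=> a b; apply/ffunP => j; rewrite !ffunE scalerDl. Qed.

HB.instance Definition _ := GRing.Zmodule_isLmodule.Build K prod_lmod
  prod_scaleA prod_scale1 prod_scaleDr prod_scaleDl.

Lemma prod_lmodDE u v j : (u + v) j = u j + v j. Proof. exact: ffunE. Qed.
Lemma prod_lmodNE u j : (- u) j = - u j. Proof. exact: ffunE. Qed.
Lemma prod_lmodZE a u j : (a *: u) j = a *: u j. Proof. exact: ffunE. Qed.
Lemma prod_lmod0E j : (0 : prod_lmod) j = 0. Proof. exact: ffunE. Qed.

End ProductModule.

(* The two-sided inverse of [f] when [f] is bijective; unspecified otherwise. *)
Definition inverse_operator (U V : zmodType) (f : U -> V) : V -> U :=
  fun v => xget 0 [set u | f u = v]%classic.

(* The second index runs over ['I_N.+1], i.e. 0, ..., N.  Operators that lower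
   an index are shifted so that both indices are naturals:
     d i j : Z i j -> Z i.+1 j     is d^{i,j},
     S i j : Z i j.+1 -> Z i.+1 j  is S^{i,j+1}  (S^{i,0} = 0),
     P i j : Z i.+1 j -> Z i j     is P^{i+1,j}  (P^{0,j} = 0). *)
Section TwistedComplex.
Variables (R : realType) (k : scalar_kind) (N : nat).
Variable Z : nat -> nat -> hilbertType R k.
Variable d : forall i j, {linear Z i j -> Z i.+1 j}.
Variable S : forall i j, {linear Z i j.+1 -> Z i.+1 j}.
Variable P : forall i j, {linear Z i.+1 j -> Z i j}.

Definition Y (i : nat) := prod_lmod (fun j : 'I_N.+1 => Z i j).

Definition dY (i : nat) (u : Y i) : Y i.+1 :=
  finfun (fun j : 'I_N.+1 => d i j (u j)).

(* [PY i] is the operator P^{i+1} : Y^{i+1} -> Y^i. *)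
Definition PY (i : nat) (u : Y i.+1) : Y i :=
  finfun (fun j : 'I_N.+1 => P i j (u j)).

Definition SY (i : nat) (u : Y i) : Y i.+1 :=
  finfun (fun j : 'I_N.+1 =>
    if @idP (j.+1 < N.+1)%N is ReflectT lt_j1_N1
    then S i j (u (Ordinal lt_j1_N1)) else 0 : Z i.+1 j).

Definition dV (i : nat) (u : Y i) : Y i.+1 := dY u - SY u.

Definition PS (i : nat) (u : Y i) : Y i := PY (SY u).

Definition IPS (i : nat) (u : Y i) : Y i := u - PS u.

Definition FY (i : nat) : Y i -> Y i := inverse_operator (@IPS i).

(* [PV i] is the operator P_V^{i+1} = F^i P^{i+1} (F^{i+1})^{-1}. *)
Definition PV (i : nat) (u : Y i.+1) : Y i :=
  FY (PY (inverse_operator (@FY i.+1) u)).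

End TwistedComplex.

(* Main.v *)
(* On Y^{i+1} one has P d + d P = I, so dS = -Sd and SS = 0 give
     (I - P S)(d - S) = d - S + P d S = d - d P S = d (I - P S),
   that is, d_V = F d F^{-1}.  Since also P_V = F P F^{-1}, both identities are
   the conjugates by F of those satisfied by d and P. *)
Require Import Defs.
From HB Require Import structures.
From mathcomp Require Import all_boot all_order all_algebra.
From mathcomp Require Import all_classical all_reals all_analysis.

Set Implicit Arguments.
Unset Strict Implicit.
Unset Printing Implicit Defensive.

Import Order.TTheory GRing.Theory Num.Theory.
Import numFieldNormedType.Exports.

Local Open Scope ring_scope.

Lemma inverse_operatorE (U V : zmodType) (f : U -> V) (g : V -> U) :
  cancel f g -> cancel g f -> inverse_operator f =1 g.
Proof.
move=> fK gK v; rewrite /inverse_operator.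
by case: xgetP => [u _ <- | /(_ (g v))]; [rewrite fK | case; exact: gK].
Qed.

(** * Neumann series of a nilpotent additive map *)

Section NeumannSeries.
Variables (V : zmodType) (f : {additive V -> V}) (m : nat).
Hypothesis iter_f0 : forall u, iter m f u = 0.

(** Telescoping: split the sum over [l < m.+1] at either end. Dropping [l = 0] removes [u] and
    leaves the image of the shorter sum under [f]; dropping [l = m] removes a term that is zero by
    nilpotency. *)
Lemma raddf_sum_iter u :
  f (\sum_(l < m) iter l f u) = \sum_(l < m) iter l f u - u.
Proof.
rewrite raddf_sum; apply: (addrI u); rewrite [RHS]addrC subrK.
rewrite -[LHS](big_ord_recl m (fun l : 'I_m.+1 => iter l f u)) big_ord_recr /=.
by rewrite iter_f0 addr0.
Qed.

Lemma neumann_rightK :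
  cancel (fun u => \sum_(l < m) iter l f u) (fun u => u - f u).
Proof. by move=> u; rewrite raddf_sum_iter subKr. Qed.

Lemma neumann_leftK :
  cancel (fun u => u - f u) (fun u => \sum_(l < m) iter l f u).
Proof.
move=> u.
(* [f] commutes with its own iterates, so this order of composition reduces to the same telescoping
   identity. *)
have iterB l : iter l f (u - f u) = iter l f u - iter l.+1 f u.
  by elim: l => // l IHl; rewrite iterS IHl raddfB.
rewrite (eq_bigr _ (fun (l : 'I_m) _ => iterB l)) sumrB.
have := raddf_sum_iter u; rewrite raddf_sum => ->.
by rewrite subKr.
Qed.

End NeumannSeries.

(** * The operators on the product spaces and the inverse of I - PS *)

Section TwistedComplexTheory.
Variables (R : realType) (k : scalar_kind) (N : nat).
Variable Z : nat -> nat -> hilbertType R k.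
Variable d : forall i j, {linear Z i j -> Z i.+1 j}.
Variable S : forall i j, {linear Z i j.+1 -> Z i.+1 j}.
Variable P : forall i j, {linear Z i.+1 j -> Z i j}.

Local Notation Y := (Y N Z).
Local Notation dY := (@dY R k N Z d _).
Local Notation SY := (@SY R k N Z S _).
Local Notation PY := (@PY R k N Z P _).
Local Notation PS i := (@PS R k N Z S P i).
Local Notation IPS i := (@IPS R k N Z S P i).
Local Notation FY i := (@FY R k N Z S P i).
Local Notation dV := (@dV R k N Z d S _).
Local Notation PV := (@PV R k N Z S P _).

(** Naming the projection lets it carry an additive structure, so that the [raddf] lemmas apply to
    components. *)
Definition coord i (j : 'I_N.+1) (u : Y i) : Z i j := u j.

Lemma coord_is_zmod_morphism i j : zmod_morphism (@coord i j).
Proof.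
by move=> u v; apply: etrans (prod_lmodDE _ _ _) _; congr (_ + _);
  exact: prod_lmodNE.
Qed.

HB.instance Definition _ i (j : 'I_N.+1) :=
  GRing.isZmodMorphism.Build (Y i) (Z i j) (@coord i j)
    (@coord_is_zmod_morphism i j).

Lemma coordP i (u v : Y i) : (forall j, coord j u = coord j v) -> u = v.
Proof. by move=> eq_uv; apply/ffunP. Qed.

Lemma coord_dY i (u : Y i) j : coord j (dY u) = d i j (coord j u).
Proof. exact: ffunE. Qed.

Lemma coord_PY i (u : Y i.+1) j : coord j (PY u) = P i j (coord j u).
Proof. exact: ffunE. Qed.

Lemma coord_SY i (u : Y i) (j : 'I_N.+1) (j_lt : (j.+1 < N.+1)%N) :
  coord j (SY u) = S i j (coord (Ordinal j_lt) u).
Proof.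
rewrite [LHS]ffunE.
(* The match in [SY] builds its ordinal from its own proof of the bound; proof irrelevance
   identifies it with the given one. *)
destruct (@idP (j.+1 < N.+1)%N) as [j_lt'|j_ge]; last by case: j_ge.
by rewrite (bool_irrelevance j_lt' j_lt).
Qed.

Lemma coord_SY0 i (u : Y i) (j : 'I_N.+1) : (N <= j)%N -> coord j (SY u) = 0.
Proof.
rewrite [LHS]ffunE => N_le.
destruct (@idP (j.+1 < N.+1)%N) as [j_lt|]; last by [].
by have := j_lt; rewrite {1}ltnS ltnNge N_le.
Qed.

Lemma dY_is_zmod_morphism i : zmod_morphism (dY : Y i -> Y i.+1).
Proof.
by move=> u v; apply: coordP => j; rewrite raddfB /= !coord_dY !raddfB.
Qed.

Lemma PY_is_zmod_morphism i : zmod_morphism (PY : Y i.+1 -> Y i).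
Proof.
by move=> u v; apply: coordP => j; rewrite raddfB /= !coord_PY !raddfB.
Qed.

Lemma SY_is_zmod_morphism i : zmod_morphism (SY : Y i -> Y i.+1).
Proof.
move=> u v; apply: (@coordP i.+1) => j; rewrite raddfB /=.
have [N_le|j_lt] := leqP N j; first by rewrite !coord_SY0 // subr0.
by rewrite !(coord_SY _ (j_lt : (j.+1 < N.+1)%N)) !raddfB.
Qed.

HB.instance Definition _ i :=
  GRing.isZmodMorphism.Build (Y i) (Y i.+1) (@Defs.dY R k N Z d i)
    (@dY_is_zmod_morphism i).
HB.instance Definition _ i :=
  GRing.isZmodMorphism.Build (Y i) (Y i.+1) (@Defs.SY R k N Z S i)
    (@SY_is_zmod_morphism i).
HB.instance Definition _ i :=
  GRing.isZmodMorphism.Build (Y i.+1) (Y i) (@Defs.PY R k N Z P i)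
    (@PY_is_zmod_morphism i).

Lemma PS_is_zmod_morphism i : zmod_morphism (PS i).
Proof. by move=> u v; rewrite /Defs.PS !raddfB. Qed.

HB.instance Definition _ i :=
  GRing.isZmodMorphism.Build (Y i) (Y i) (@Defs.PS R k N Z S P i)
    (@PS_is_zmod_morphism i).

(** Component [j] of [PS u] depends only on component [j.+1] of [u], so [l] applications reach for
    index [j + l], which is out of range. *)
Lemma iter_PS_coord0 i l (u : Y i) (j : 'I_N.+1) :
  (N < j + l)%N -> coord j (iter l (PS i) u) = 0.
Proof.
elim: l j => [|l IHl] j; first by rewrite addn0 ltnNge -ltnS ltn_ord.
move=> N_lt; rewrite iterS /Defs.PS coord_PY.
have [N_le|j_lt] := leqP N j; first by rewrite coord_SY0 // raddf0.
by rewrite (coord_SY _ (j_lt : (j.+1 < N.+1)%N)) IHl ?raddf0 //= addSnnS.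
Qed.

Lemma iter_PS0 i m (u : Y i) : (N < m)%N -> iter m (PS i) u = 0.
Proof.
move=> N_lt; apply: coordP => j; rewrite raddf0 /=.
exact/iter_PS_coord0/(leq_trans N_lt)/leq_addl.
Qed.

Lemma FYE i m : (N < m)%N -> FY i =1 fun u => \sum_(l < m) iter l (PS i) u.
Proof.
move=> N_lt; have PS0 u := iter_PS0 (i := i) u N_lt.
apply: inverse_operatorE;
  [exact: neumann_leftK PS0 | exact: neumann_rightK PS0].
Qed.

Lemma IPSK i : cancel (IPS i) (FY i).
Proof.
move=> u; rewrite (FYE (ltnSn N)).
exact: (neumann_leftK (fun u => iter_PS0 u (ltnSn N))).
Qed.

Lemma FYK i : cancel (FY i) (IPS i).
Proof.
move=> u; rewrite (FYE (ltnSn N)).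
exact: (neumann_rightK (fun u => iter_PS0 u (ltnSn N))).
Qed.

(** [FY] is defined by choice of a preimage; its additivity is inherited from [IPS] through
    injectivity of the latter. *)
Lemma FYD i : {morph FY i : u v / u + v}.
Proof.
move=> u v; apply: (can_inj (@IPSK i)); rewrite FYK.
by rewrite /Defs.IPS raddfD opprD addrACA -!/(IPS i _) !FYK.
Qed.

Lemma PVE i (u : Y i.+1) : PV u = FY i (PY (IPS i.+1 u)).
Proof. by rewrite /Defs.PV (inverse_operatorE (@FYK i.+1) (@IPSK i.+1)). Qed.

(** * Transfer of the homotopy identities by conjugation with F *)

Hypothesis dS : forall i j (x : Z i j.+1),
  d i.+1 j (S i j x) = - S i.+1 j (d i j.+1 x).
Hypothesis SS : forall i j (x : Z i j.+2), S i.+1 j (S i j.+1 x) = 0.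
Hypothesis dPPd : forall i j (x : Z i.+1 j),
  d i j (P i j x) + P i.+1 j (d i.+1 j x) = x.
Hypothesis dPd : forall j (x : Z 0%N j),
  d 0%N j (P 0%N j (d 0%N j x)) = d 0%N j x.

Lemma dYSY i (u : Y i) : dY (SY u) = - SY (dY u).
Proof.
apply: coordP => j; rewrite raddfN /= coord_dY.
have [N_le|j_lt] := leqP N j; first by rewrite !coord_SY0 // raddf0 oppr0.
by rewrite !(coord_SY _ (j_lt : (j.+1 < N.+1)%N)) dS coord_dY.
Qed.

Lemma SYSY i (u : Y i) : SY (SY u) = 0.
Proof.
apply: coordP => j; rewrite raddf0 /=.
(* The two shifts read component [j + 2]; in the last two components one of them leaves the range,
   and [SS] handles the others. *)
have [N_le|j_lt] := leqP N j; first by rewrite !coord_SY0.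
rewrite (coord_SY _ (j_lt : (j.+1 < N.+1)%N)).
have [N_le|j1_lt] := leqP N j.+1; first by rewrite coord_SY0 // raddf0.
by rewrite (coord_SY (j := Ordinal _) _ (j1_lt : (j.+2 < N.+1)%N)) SS.
Qed.

Lemma dYPY i (u : Y i.+1) : dY (PY u) + PY (dY u) = u.
Proof. by apply: coordP => j; rewrite raddfD /= !(coord_dY, coord_PY) dPPd. Qed.

Lemma dYPYdY0 (u : Y 0) : dY (PY (dY u)) = dY u.
Proof. by apply: coordP => j; rewrite !(coord_dY, coord_PY) dPd. Qed.

Lemma IPS_dV i (u : Y i) : IPS i.+1 (dV u) = dY (IPS i u).
Proof.
rewrite /Defs.IPS /Defs.dV /Defs.PS !raddfB /= SYSY raddf0 !oppr0 addr0.
have -> : SY (dY u) = - dY (SY u) by rewrite dYSY opprK.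
rewrite raddfN opprK -addrA; congr (_ + _).
(* [SY u] has degree at least 1, so the homotopy identity applies to it even when [i = 0]; this is
   what makes the degree-zero case work. *)
by rewrite -{1}(dYPY (SY u)) opprD addrNK.
Qed.

Lemma dV_FY i (u : Y i) : dV (FY i u) = FY i.+1 (dY u).
Proof. by rewrite -[LHS]IPSK IPS_dV FYK. Qed.

Lemma dV_PV i (u : Y i.+1) : dV (PV u) + PV (dV u) = u.
Proof. by rewrite !PVE dV_FY IPS_dV -FYD dYPY IPSK. Qed.

Lemma dV_PV_dV0 (u : Y 0) : dV (PV (dV u)) = dV u.
Proof. by rewrite PVE dV_FY IPS_dV dYPYdY0 -IPS_dV IPSK. Qed.

End TwistedComplexTheory.

Theorem theorem2 (R : realType) (k : scalar_kind) (n N : nat)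
  (Z : nat -> nat -> hilbertType R k)
  (Z_out : forall i j, ((n < i) || (N < j))%N -> forall x : Z i j, x = 0)
  (d : forall i j, {linear Z i j -> Z i.+1 j})
  (d_bounded : forall i j, bounded_operator (d i j))
  (dd : forall i j (x : Z i j), d i.+1 j (d i j x) = 0)
  (S : forall i j, {linear Z i j.+1 -> Z i.+1 j})
  (S_bounded : forall i j, bounded_operator (S i j))
  (dS : forall i j (x : Z i j.+1),
    d i.+1 j (S i j x) = - S i.+1 j (d i j.+1 x))
  (SS : forall i j (x : Z i j.+2), S i.+1 j (S i j.+1 x) = 0)
  (P : forall i j, {linear Z i.+1 j -> Z i j})
  (P_bounded : forall i j, bounded_operator (P i j))
  (dPPd : forall i j (x : Z i.+1 j),
    d i j (P i j x) + P i.+1 j (d i.+1 j x) = x)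
  (dPd : forall j (x : Z 0%N j),
    d 0%N j (P 0%N j (d 0%N j x)) = d 0%N j x) :
  [/\ forall i : nat, bijective (@IPS R k N Z S P i),
      forall (i m : nat) (u : Y N Z i), (N < m)%N ->
        FY S P u = \sum_(l < m) iter l (PS S P (i := i)) u,
      forall (i m : nat) (u : Y N Z i.+1), (N < m)%N ->
        PV S P u = \sum_(l < m) iter l (PS S P (i := i)) (PY P (IPS S P u)),
      forall (i : nat) (u : Y N Z i.+1),
        dV d S (PV S P u) + PV S P (dV d S u) = u
    & forall u : Y N Z 0%N, dV d S (PV S P (dV d S u)) = dV d S u].
Proof.
split.
- by move=> i; exists (@FY R k N Z S P i); [exact: IPSK | exact: FYK].
- by move=> i m u; move/FYE; exact.
- by move=> i m u N_lt; rewrite PVE (FYE _ _ N_lt).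
- by move=> i u; exact: dV_PV.
- by move=> u; exact: dV_PV_dV0.
Qed.
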